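(* Let $m=2h$, let $\mathcal{A}\in\mathbb{R}^{m\times p\times n}$ be $\star_{\mathbf{M}}$-symmetric, and let $\mathcal{A}=\mathcal{U}\star_{\mathbf{M}}\mathcal{S}\star_{\mathbf{M}}\mathcal{V}^{\mathsf T}$ be a symmetry-preserving $\star_{\mathbf{M}}$-SVD (sptSVD) of $\mathcal{A}$ with $r$ singular tubes. For $1\le k\le r$ let $$\mathcal{A}_k=\mathcal{U}_{:,1:k,:}\star_{\mathbf{M}}\mathcal{S}_{1:k,1:k,:}\star_{\mathbf{M}}(\mathcal{V}_{:,1:k,:})^{\mathsf T}$$ be its truncation to the $k$ largest singular tubes. Then $\mathcal{A}_k$ is a best $\star_{\mathbf{M}}$-rank-$k$ approximation of $\mathcal{A}$ in the Frobenius norm, i.e. $$\|\mathcal{A}-\mathcal{A}_k\|_F\le\|\mathcal{A}-\mathcal{X}\star_{\mathbf{M}}\mathcal{Y}\|_F\qquad\text{for all }\mathcal{X}\in\mathbb{R}^{m\times k\times n},\ \mathcal{Y}\in\mathbb{R}^{k\times p\times n},$$ and $\mathcal{A}_k$ is $\star_{\mathbf{M}}$-symmetric.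
   Context: Standing assumption: $\mathbf{M}=cW$ is a real $n\times n$ matrix with $W$ orthogonal and $c\neq 0$. Third-order tensors are real arrays $\mathcal{A}\in\mathbb{R}^{m\times p\times n}$; $\|\mathcal{A}\|_F^2=\sum_{i,j,k}\mathcal{A}_{i,j,k}^2$. Sub-arrays use MATLAB notation. The mode-3 product $\mathcal{A}\times_3\mathbf{M}$ applies $\mathbf{M}$ to every tube $\mathcal{A}_{i,j,:}\in\mathbb{R}^n$. The transform of $\mathcal{A}$ is $\widehat{\mathcal{A}}=\mathcal{A}\times_3\mathbf{M}$, with transform-domain frontal slices (faces) $\hat A^{(i)}=\widehat{\mathcal{A}}_{:,:,i}\in\mathbb{R}^{m\times p}$, $i=1,\dots,n$. $\star_{\mathbf{M}}$-product: for $\mathcal{A}\in\mathbb{R}^{m\times p\times n}$, $\mathcal{B}\in\mathbb{R}^{p\times\ell\times n}$, $\mathcal{C}=\mathcal{A}\star_{\mathbf{M}}\mathcal{B}\in\mathbb{R}^{m\times\ell\times n}$ is the tensor with $\hat C^{(i)}=\hat A^{(i)}\hat B^{(i)}$ for all $i$. The transpose $\mathcal{A}^{\mathsf T}\in\mathbb{R}^{p\times m\times n}$ has faces $(\hat A^{(i)})^{\mathsf T}$. Economy $\star_{\mathbf{M}}$-SVD of $\mathcal{B}\in\mathbb{R}^{h\times p\times n}$: a factorization $\mathcal{B}=\mathcal{U}_0\star_{\mathbf{M}}\mathcal{S}_0\star_{\mathbf{M}}\mathcal{V}_0^{\mathsf T}$ with $\mathcal{U}_0\in\mathbb{R}^{h\times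 r\times n}$, $\mathcal{S}_0\in\mathbb{R}^{r\times r\times n}$, $\mathcal{V}_0\in\mathbb{R}^{p\times r\times n}$, such that for each $i$ the faces satisfy: $\hat U_0^{(i)},\hat V_0^{(i)}$ have orthonormal columns and $\hat S_0^{(i)}$ is diagonal with nonnegative, non-increasing diagonal entries. Reflection: $R$ is the $h\times h$ row-reversal (anti-identity) matrix, and $\mathcal{R}\in\mathbb{R}^{h\times h\times n}$ is the tensor all of whose transform-domain faces equal $R$. $\star_{\mathbf{M}}$-symmetric: $\mathcal{A}\in\mathbb{R}^{m\times p\times n}$, $m=2h$, is $\star_{\mathbf{M}}$-symmetric if $\mathcal{A}_{1:h,:,:}=\mathcal{R}\star_{\mathbf{M}}\mathcal{A}_{h+1:m,:,:}$. Symmetry-preserving $\star_{\mathbf{M}}$-SVD (sptSVD) of a $\star_{\mathbf{M}}$-symmetric $\mathcal{A}$: form $\mathcal{B}=\tfrac12(\mathcal{A}_{1:h,:,:}+\mathcal{R}\star_{\mathbf{M}}\mathcal{A}_{h+1:m,:,:})$, take an economy $\star_{\mathbf{M}}$-SVD $\mathcal{B}=\mathcal{U}_0\star_{\mathbf{M}}\mathcal{S}_0\star_{\mathbf{M}}\mathcal{V}_0^{\mathsf T}$, and set $\mathcal{U}=\tfrac{1}{\sqrt2}\begin{bmatrix}\mathcal{U}_0\\ \mathcal{R}\star_{\mathbf{M}}\mathcal{U}_0\end{bmatrix}$ (stacked along mode 1), $\mathcal{S}=\sqrt2\,\mathcal{S}_0$, $\mathcal{V}=\mathcal{V}_0$;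 then $\mathcal{A}=\mathcal{U}\star_{\mathbf{M}}\mathcal{S}\star_{\mathbf{M}}\mathcal{V}^{\mathsf T}$. The singular tubes $\mathcal{S}_{j,j,:}$, $j=1,\dots,r$, are ordered by non-increasing Frobenius norm. *)

(* Defs.v *)
From mathcomp Require Import all_boot all_order all_algebra.
From mathcomp Require Import reals.

Set Implicit Arguments.
Unset Strict Implicit.
Unset Printing Implicit Defensive.

Import GRing.Theory Num.Theory.
Local Open Scope ring_scope.

(* An m x p x n array is stored by frontal slices: the entry of A at position *)
(* (i, j, k) is [A k i j], and its tube at (i, j) is [fun k => A k i j].      *)
Definition tensor (R : realType) (m p n : nat) := {ffun 'I_n -> 'M[R]_(m, p)}.

Section Tensors.
Variables (R : realType) (n : nat) (M : 'M[R]_n).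
Implicit Types m p l h r k : nat.

Definition frobenius m p (A : tensor R m p n) : R :=
  Num.sqrt (\sum_(i < m) \sum_(j < p) \sum_(k < n) A k i j ^+ 2).

(* The matrix N applied to every tube: its k-th slice has (i, j) entry        *)
(* \sum_l N k l * A l i j.                                                    *)
Definition mode3 (N : 'M[R]_n) m p (A : tensor R m p n) : tensor R m p n :=
  [ffun k => \sum_(l < n) N k l *: A l].

Definition face m p (A : tensor R m p n) (i : 'I_n) : 'M[R]_(m, p) :=
  mode3 M A i.

(* The tensor with prescribed transform-domain faces. It is characterized by  *)
(* [face_of_faces] only for invertible M, since [invmx M] is M otherwise.     *)
Definition of_faces m p (F : 'I_n -> 'M[R]_(m, p)) : tensor R m p n :=
  mode3 (invmx M) [ffun i => F i].

Lemma face_of_faces m p (F : 'I_n -> 'M[R]_(m, p)) (i : 'I_n) :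
  M \in unitmx -> face (of_faces F) i = F i.
Proof.
move=> uM; rewrite /face /of_faces /mode3 ffunE.
under eq_bigr do rewrite ffunE scaler_sumr.
rewrite exchange_big /=.
transitivity (\sum_(j < n) (M *m invmx M) i j *: F j); last first.
  rewrite mulmxV // (bigD1 i) //= mxE eqxx scale1r big1 ?addr0 // => j ji.
  by rewrite mxE eq_sym (negPf ji) scale0r.
apply: eq_bigr => j _; rewrite mxE scaler_suml; apply: eq_bigr => l _.
by rewrite ffunE scalerA.
Qed.

Definition star m p l (A : tensor R m p n) (B : tensor R p l n) :
    tensor R m l n :=
  of_faces (fun i => face A i *m face B i).

Definition ttr m p (A : tensor R m p n) : tensor R p m n :=
  of_faces (fun i => (face A i)^T).

Definition upper h p (A : tensor R (h + h) p n) : tensor R h p n :=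
  [ffun k => usubmx (A k)].

Definition lower h p (A : tensor R (h + h) p n) : tensor R h p n :=
  [ffun k => dsubmx (A k)].

Definition stack h p (A B : tensor R h p n) : tensor R (h + h) p n :=
  [ffun k => col_mx (A k) (B k)].

Definition lead_cols m r k (lekr : (k <= r)%N) (A : tensor R m r n) :
    tensor R m k n :=
  [ffun l => colsub (widen_ord lekr) (A l)].

Definition lead_block r k (lekr : (k <= r)%N) (A : tensor R r r n) :
    tensor R k k n :=
  [ffun l => mxsub (widen_ord lekr) (widen_ord lekr) (A l)].

Definition reversal_mx h : 'M[R]_h := \matrix_(i, j) (j == rev_ord i)%:R.

Definition reversal h : tensor R h h n := of_faces (fun=> reversal_mx h).

Definition star_symmetric h p (A : tensor R (h + h) p n) : Prop :=
  upper A = star (reversal h) (lower A).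

Definition economy_SVD h p r (B : tensor R h p n)
    (U : tensor R h r n) (S : tensor R r r n) (V : tensor R p r n) : Prop :=
  B = star (star U S) (ttr V) /\
  forall i : 'I_n,
    [/\ (face U i)^T *m face U i = 1%:M,
        (face V i)^T *m face V i = 1%:M,
        is_diag_mx (face S i),
        forall j : 'I_r, 0 <= face S i j j &
        forall j j' : 'I_r, (j <= j')%N -> face S i j' j' <= face S i j j].

(* The identity A = U * S * V^T, for star-symmetric A, and the non-increasing *)
(* Frobenius norms of the singular tubes of S, for M a nonzero multiple of an *)
(* orthogonal matrix, both follow from these conditions.                      *)
Definition sptSVD h p r (A : tensor R (h + h) p n)
    (U : tensor R (h + h) r n) (S : tensor R r r n) (V : tensor R p r n) :
    Prop :=
  exists (U0 : tensor R h r n) (S0 : tensor R r r n) (V0 : tensor R p r n),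
    [/\ economy_SVD (2^-1 *: (upper A + star (reversal h) (lower A))) U0 S0 V0,
        U = (Num.sqrt 2)^-1 *: stack U0 (star (reversal h) U0),
        S = Num.sqrt 2 *: S0 &
        V = V0].

Definition truncation m p r k (lekr : (k <= r)%N)
    (U : tensor R m r n) (S : tensor R r r n) (V : tensor R p r n) :
    tensor R m p n :=
  star (star (lead_cols lekr U) (lead_block lekr S)) (ttr (lead_cols lekr V)).

End Tensors.

(* Main.v *)
(** Since M is a multiple of an orthogonal matrix, the squared Frobenius norm of
    a tensor is c^-2 times the sum of those of its faces, so optimality is the
    Eckart-Young theorem on each face. There, if Q is the orthogonal projection
    onto the row space of Y, then ||A - XY||^2 >= ||A||^2 - ||AQ||^2, and ||AQ||^2
    is the sum of s_j^2 w_j for the weights w_j = v_j^T Q v_j, which lie in [0, 1]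
    and have sum at most \tr Q <= k. Because the reversal is an orthogonal
    involution, U inherits orthonormal columns from U0, and it is itself
    symmetric; so is every product U N, in particular the truncation. *)

Require Import Defs.
From mathcomp Require Import all_boot all_order all_algebra.
From mathcomp Require Import reals.

Set Implicit Arguments.
Unset Strict Implicit.
Unset Printing Implicit Defensive.

Import Order.TTheory GRing.Theory Num.Theory.
Local Open Scope ring_scope.

(** * Orthogonal projections and the Eckart-Young theorem for a single matrix *)

Section EckartYoung.
Variable F : realFieldType.
Implicit Types m p r k : nat.

(** The squared Frobenius norm in trace form, so that cyclicity of the trace brings orthonormal
    factors together and cancels them. *)
Definition mxnormsq m p (A : 'M[F]_(m, p)) : F := \tr (A^T *m A).

Lemma mxnormsqE m p (A : 'M[F]_(m, p)) :
  mxnormsq A = \sum_i \sum_j A i j ^+ 2.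
Proof.
rewrite /mxnormsq /mxtrace exchange_big; apply: eq_bigr => j _.
by rewrite mxE; apply: eq_bigr => i _; rewrite mxE expr2.
Qed.

Lemma mxnormsq_ge0 m p (A : 'M[F]_(m, p)) : 0 <= mxnormsq A.
Proof.
rewrite mxnormsqE; apply: sumr_ge0 => i _; apply: sumr_ge0 => j _.
exact: sqr_ge0.
Qed.

Lemma mxnormsq_eq0 m p (A : 'M[F]_(m, p)) : mxnormsq A = 0 -> A = 0.
Proof.
rewrite mxnormsqE => A0; apply/matrixP => i j; rewrite mxE.
have sq_ge0 i' j' : true -> 0 <= A i' j' ^+ 2 by rewrite sqr_ge0.
have row_ge0 i' : true -> 0 <= \sum_j A i' j ^+ 2.
  by move=> _; apply: sumr_ge0 => j' _; apply: sq_ge0.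
move/(psumr_eq0P row_ge0): A0 => /(_ i isT) /(psumr_eq0P (sq_ge0 i)).
by move=> /(_ j isT)/eqP; rewrite sqrf_eq0 => /eqP.
Qed.

Definition orthoproj p (Q : 'M[F]_p) := Q^T = Q /\ Q *m Q = Q.

Lemma orthoproj_compl p (Q : 'M[F]_p) : orthoproj Q -> orthoproj (1%:M - Q).
Proof.
move=> [symQ idemQ]; split; first by rewrite linearB /= trmx1 symQ.
by rewrite mulmxBl mul1mx mulmxBr mulmx1 idemQ subrr subr0.
Qed.

Lemma orthoproj_isometry p r (V : 'M[F]_(p, r)) :
  V^T *m V = 1%:M -> orthoproj (V *m V^T).
Proof.
move=> VV; split; first by rewrite trmx_mul trmxK.
by rewrite mulmxA -(mulmxA V) VV mulmx1.
Qed.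

(** Symmetry and idempotence make the squared norm linear in [Q]; Pythagoras then reduces to
    additivity of the trace. *)
Lemma mxnormsq_orthoproj m p (A : 'M[F]_(m, p)) (Q : 'M[F]_p) :
  orthoproj Q -> mxnormsq (A *m Q) = \tr (A^T *m A *m Q).
Proof.
move=> [symQ idemQ].
by rewrite /mxnormsq trmx_mul symQ -!mulmxA mxtrace_mulC -!mulmxA idemQ.
Qed.

Lemma mxnormsq_orthoprojD m p (A : 'M[F]_(m, p)) (Q : 'M[F]_p) :
  orthoproj Q -> mxnormsq A = mxnormsq (A *m Q) + mxnormsq (A *m (1%:M - Q)).
Proof.
move=> oQ; rewrite !mxnormsq_orthoproj //; last exact: orthoproj_compl.
by rewrite -mxtraceD -mulmxDr addrC subrK mulmx1.
Qed.

(** [V^T Q V] is the Gram matrix of [Q V], so its diagonal entries are sums of squares. *)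
Lemma quad_orthoproj_ge0 p r (V : 'M[F]_(p, r)) (Q : 'M[F]_p) (j : 'I_r) :
  orthoproj Q -> 0 <= (V^T *m Q *m V) j j.
Proof.
move=> [symQ idemQ].
have -> : V^T *m Q *m V = (Q *m V)^T *m (Q *m V).
  by rewrite trmx_mul symQ !mulmxA -(mulmxA _ Q Q) idemQ.
by rewrite mxE; apply: sumr_ge0 => i _; rewrite mxE -expr2 sqr_ge0.
Qed.

Lemma quad_orthoproj_le1 p r (V : 'M[F]_(p, r)) (Q : 'M[F]_p) (j : 'I_r) :
  V^T *m V = 1%:M -> orthoproj Q -> (V^T *m Q *m V) j j <= 1.
Proof.
move=> VV /orthoproj_compl/(quad_orthoproj_ge0 V j).
by rewrite mulmxBr mulmxBl mulmx1 VV !mxE eqxx subr_ge0.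
Qed.

(** Pythagoras for [Q] along the projection [V V^T]: [Q] has squared norm [\tr Q], and its component
    [Q V V^T] has squared norm [\tr (V^T Q V)]. *)
Lemma trace_orthoproj_le p r (V : 'M[F]_(p, r)) (Q : 'M[F]_p) :
  V^T *m V = 1%:M -> orthoproj Q -> \tr (V^T *m Q *m V) <= \tr Q.
Proof.
move=> VV oQ; have oP := orthoproj_isometry VV; have [symQ idemQ] := oQ.
have := mxnormsq_orthoprojD Q oP; have := mxnormsq_ge0 (Q *m (1%:M - V *m V^T)).
rewrite (mxnormsq_orthoproj _ oP) [mxnormsq Q]/mxnormsq symQ idemQ.
rewrite mulmxA [\tr (_ *m V *m V^T)]mxtrace_mulC mulmxA.
by move=> ? ->; rewrite lerDl.
Qed.

(** If [K B B^T = 0], then [K B B^T K^T = 0], so [K B] has norm zero and [K = 0] by freeness of the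
    rows. *)
Lemma gram_unitmx d p (B : 'M[F]_(d, p)) : row_free B -> B *m B^T \in unitmx.
Proof.
move=> freeB; rewrite -row_free_unit -kermx_eq0 -(mulmx_free_eq0 _ freeB).
apply/eqP; apply: trmx_inj; rewrite trmx0; apply: mxnormsq_eq0.
by rewrite /mxnormsq trmxK trmx_mul mulmxA -(mulmxA _ B) mulmx_ker mul0mx mxtrace0.
Qed.

Lemma orthoproj_rows k p (Y : 'M[F]_(k, p)) :
  exists Q, [/\ orthoproj Q, Y *m Q = Y & \tr Q <= k%:R].
Proof.
(* [Y] may be rank-deficient, so the Gram matrix is formed from a basis of its row space. *)
have [d [B [led freeB subYB]]] :
    exists d (B : 'M[F]_(d, p)), [/\ (d <= k)%N, row_free B & (Y <= B)%MS].
  exists (\rank Y), (row_base Y).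
  by rewrite rank_leq_row row_base_free eq_row_base.
set G := B *m B^T; have uG : G \in unitmx := gram_unitmx freeB.
have symG : (invmx G)^T = invmx G by rewrite trmx_inv trmx_mul trmxK.
exists (B^T *m invmx G *m B); split.
- split; first by rewrite !trmx_mul trmxK symG mulmxA.
  by rewrite !mulmxA -(mulmxA _ B) -/G mulmxKV.
- case/submxP: subYB => Z ->.
  by rewrite !mulmxA -(mulmxA Z) -/G mulmxK.
- by rewrite mxtrace_mulC mulmxA -/G mulmxV // mxtrace1 ler_nat.
Qed.

Lemma sum_widen_ord k r (lekr : (k <= r)%N) (f : 'I_r -> F) :
  \sum_(j < r | (j < k)%N) f j = \sum_(j < k) f (widen_ord lekr j).
Proof. by rewrite (big_ord_narrow lekr). Qed.

(* With x = t_(k-1), each term satisfies t_j (w_j - [j < k]) <= x (w_j - [j < k]). *)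
Lemma ky_fan_weights r k (t w : 'I_r -> F) :
  (0 < k <= r)%N ->
  (forall j, 0 <= t j) -> (forall j j' : 'I_r, (j <= j')%N -> t j' <= t j) ->
  (forall j, 0 <= w j <= 1) -> \sum_j w j <= k%:R ->
  \sum_j t j * w j <= \sum_(j < r | (j < k)%N) t j.
Proof.
move=> /andP[k_gt0 lekr] t0 tS w01 sw.
have ltk : (k.-1 < r)%N by rewrite prednK.
pose x := t (Ordinal ltk).
have H j : t j * (w j - (j < k)%:R) <= x * (w j - (j < k)%:R).
  have /andP[w0 w1] := w01 j; case: ltnP => jk.
    by apply: ler_wnM2r; [rewrite subr_le0 | apply: tS; rewrite /= -ltnS prednK].
  by rewrite subr0; apply: ler_wpM2r => //; apply: tS; rewrite /= (leq_trans (leq_pred k)).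
have -> : \sum_(j < r | (j < k)%N) t j = \sum_j t j * (j < k)%:R.
  by rewrite big_mkcond; apply: eq_bigr => j _; case: ifP; rewrite ?mulr1 ?mulr0.
rewrite -subr_le0 -sumrB.
under eq_bigr do rewrite -mulrBr.
apply: le_trans (ler_sum _ (fun j _ => H j)) _.
rewrite -mulr_sumr sumrB.
have -> : \sum_(j < r) (j < k)%:R = k%:R :> F.
  rewrite -[k in RHS]card_ord -sum1_card natr_sum -(sum_widen_ord lekr (fun=> 1)).
  by rewrite [RHS]big_mkcond; apply: eq_bigr => j _; case: ifP.
(* What remains is [x] times the total weight minus [k]: a nonnegative factor times a nonpositive
   one. *)
by apply: mulr_ge0_le0; rewrite ?t0 // subr_le0.
Qed.

(** The diagonal is arbitrary so that the formula covers both a matrix and the residual of its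
    truncation. *)
Lemma mxnormsq_svd m p r (U : 'M[F]_(m, r)) (d : 'rV[F]_r) (V : 'M[F]_(p, r)) :
  U^T *m U = 1%:M -> V^T *m V = 1%:M ->
  mxnormsq (U *m diag_mx d *m V^T) = \sum_j d 0 j ^+ 2.
Proof.
move=> UU VV; rewrite /mxnormsq !trmx_mul trmxK tr_diag_mx !mulmxA mxtrace_mulC.
rewrite !mulmxA VV mul1mx -[_ *m U^T *m U]mulmxA UU mulmx1 mulmx_diag.
by rewrite mxtrace_diag; apply: eq_bigr => j _; rewrite mxE expr2.
Qed.

(** Padding the truncated diagonal with zeros keeps the full factors [U] and [V], so the residual is
    a difference of diagonals. *)
Lemma truncated_svdE m p r k (lekr : (k <= r)%N)
    (U : 'M[F]_(m, r)) (d : 'rV[F]_r) (V : 'M[F]_(p, r)) :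
  colsub (widen_ord lekr) U *m
    mxsub (widen_ord lekr) (widen_ord lekr) (diag_mx d) *m
    (colsub (widen_ord lekr) V)^T =
  U *m diag_mx (\row_j (d 0 j *+ (j < k))) *m V^T.
Proof.
have widenI : injective (widen_ord lekr) by move=> a b /(congr1 val) /= /val_inj.
have -> : mxsub (widen_ord lekr) (widen_ord lekr) (diag_mx d) =
          diag_mx (\row_j d 0 (widen_ord lekr j)).
  by apply/matrixP => a b; rewrite !mxE (inj_eq widenI).
rewrite !mul_mx_diag; apply/matrixP => a b; rewrite !mxE.
transitivity (\sum_(j < r | (j < k)%N) U a j * d 0 j * V b j).
  by rewrite (sum_widen_ord lekr); apply: eq_bigr => j _; rewrite !mxE.
rewrite big_mkcond; apply: eq_bigr => j _; rewrite !mxE.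
by case: ifP; rewrite ?mulr1n // mulr0n mulr0 mul0r.
Qed.

Theorem eckart_young m p r k (lekr : (k <= r)%N) (k_gt0 : (0 < k)%N)
    (U : 'M[F]_(m, r)) (S : 'M[F]_r) (V : 'M[F]_(p, r))
    (X : 'M[F]_(m, k)) (Y : 'M[F]_(k, p)) :
  U^T *m U = 1%:M -> V^T *m V = 1%:M -> is_diag_mx S ->
  (forall j, 0 <= S j j) ->
  (forall j j' : 'I_r, (j <= j')%N -> S j' j' <= S j j) ->
  mxnormsq (U *m S *m V^T - colsub (widen_ord lekr) U *m
    mxsub (widen_ord lekr) (widen_ord lekr) S *m (colsub (widen_ord lekr) V)^T)
  <= mxnormsq (U *m S *m V^T - X *m Y).
Proof.
move=> UU VV /is_diag_mxP diagS S0 Sdec.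
pose d := \row_j S j j.
have -> : S = diag_mx d.
  apply/matrixP => i j; rewrite !mxE.
  by case: eqVneq => [->|ij]; rewrite ?mulr1n // mulr0n; apply: diagS.
have d0 j : 0 <= d 0 j by rewrite mxE.
have ddec (j j' : 'I_r) : (j <= j')%N -> d 0 j' <= d 0 j.
  by rewrite !mxE; apply: Sdec.
rewrite truncated_svdE -mulmxBl -mulmxBr -linearB /= mxnormsq_svd //.
set A := U *m diag_mx d *m V^T.
have [Q [oQ YQ trQ]] := orthoproj_rows Y.
(* Since [Y Q = Y], the complementary projection annihilates [X Y]. *)
have AXY : (A - X *m Y) *m (1%:M - Q) = A *m (1%:M - Q).
  by rewrite mulmxBl -[X *m Y *m _]mulmxA [Y *m _]mulmxBr mulmx1 YQ subrr mulmx0 subr0.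
rewrite (mxnormsq_orthoprojD _ oQ) AXY.
(* The component of [A - X Y] inside the range of [Q] is discarded. *)
apply: ler_wpDl; first exact: mxnormsq_ge0.
have -> : mxnormsq (A *m (1%:M - Q)) = \sum_j d 0 j ^+ 2 - mxnormsq (A *m Q).
  by rewrite -(mxnormsq_svd d UU VV) -/A (mxnormsq_orthoprojD A oQ) addrAC subrr add0r.
pose w j := (V^T *m Q *m V) j j.
(* After [U^T U] cancels, cyclicity leaves the trace of the squared diagonal times [V^T Q V]. *)
have -> : mxnormsq (A *m Q) = \sum_j d 0 j ^+ 2 * w j.
  rewrite mxnormsq_orthoproj // /A !trmx_mul trmxK tr_diag_mx.
  rewrite !mulmxA -[V *m _ *m U^T *m U]mulmxA UU mulmx1.
  rewrite -[V *m _ *m _]mulmxA mulmx_diag -!mulmxA mxtrace_mulC -!mulmxA.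
  rewrite mul_diag_mx; apply: eq_bigr => j _.
  by rewrite mxE mxE -expr2 /w -mulmxA.
have /ky_fan_weights-/(_ (fun j => d 0 j ^+ 2) w) : (0 < k <= r)%N by rewrite k_gt0.
move=> H.
apply: le_trans (lerB (lexx _) (H _ _ _ _)).
(* The residual diagonal is zero for [j < k] and [d 0 j] beyond, so the left side equals the tail
   sum. *)
- rewrite [leLHS](_ : _ = \sum_j d 0 j ^+ 2 - \sum_(j < r | (j < k)%N) d 0 j ^+ 2) //.
  rewrite [X in _ = _ - X]big_mkcond /= -sumrB; apply: eq_bigr => j _; rewrite !mxE.
  by case: ifP; rewrite ?mulr1n ?mulr0n ?subrr ?subr0 // expr0n.
- by move=> j; apply: sqr_ge0.
- by move=> j j' /ddec; rewrite ler_sqr // nnegrE.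
- by move=> j; rewrite /w quad_orthoproj_ge0 // quad_orthoproj_le1.
- exact: le_trans (trace_orthoproj_le VV oQ) trQ.
Qed.

End EckartYoung.

(** * Tensor operations seen on transform-domain faces *)

Section TensorFaces.
Variables (R : realType) (n : nat) (M : 'M[R]_n).
Implicit Types (m p h r k : nat) (i l : 'I_n).

Lemma faceE m p (A : tensor R m p n) i :
  face M A i = \sum_(l < n) M i l *: A l.
Proof. by rewrite /face ffunE. Qed.

Lemma faceD m p (A B : tensor R m p n) i :
  face M (A + B) i = face M A i + face M B i.
Proof.
by rewrite !faceE -big_split; apply: eq_bigr => l _; rewrite ffunE scalerDr.
Qed.

Lemma faceZ m p (a : R) (A : tensor R m p n) i :
  face M (a *: A) i = a *: face M A i.
Proof.
by rewrite !faceE scaler_sumr; apply: eq_bigr => l _; rewrite ffunE !scalerA mulrC.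
Qed.

Lemma faceB m p (A B : tensor R m p n) i :
  face M (A - B) i = face M A i - face M B i.
Proof. by rewrite faceD -scaleN1r faceZ scaleN1r. Qed.

(** A face is a linear combination of slices, so it commutes with any linear map applied slicewise;
    taking halves, columns and blocks are all instances. *)
Lemma face_linear m p m' p' (f : {linear 'M[R]_(m, p) -> 'M[R]_(m', p')})
    (A : tensor R m p n) i :
  face M [ffun l => f (A l)] i = f (face M A i).
Proof.
rewrite !faceE linear_sum; apply: eq_bigr => l _.
by rewrite ffunE linearZ.
Qed.

Lemma face_upper h p (A : tensor R (h + h) p n) i :
  face M (upper A) i = usubmx (face M A i).
Proof. exact: face_linear. Qed.

Lemma face_lower h p (A : tensor R (h + h) p n) i :
  face M (lower A) i = dsubmx (face M A i).
Proof. exact: face_linear. Qed.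

Lemma face_lead_cols m r k (lekr : (k <= r)%N) (A : tensor R m r n) i :
  face M (lead_cols lekr A) i = colsub (widen_ord lekr) (face M A i).
Proof. exact: face_linear. Qed.

Lemma face_lead_block r k (lekr : (k <= r)%N) (A : tensor R r r n) i :
  face M (lead_block lekr A) i =
  mxsub (widen_ord lekr) (widen_ord lekr) (face M A i).
Proof. exact: face_linear. Qed.

Lemma face_stack h p (A B : tensor R h p n) i :
  face M (stack A B) i = col_mx (face M A i) (face M B i).
Proof.
rewrite -[LHS]vsubmxK -face_upper -face_lower; congr col_mx; congr face.
  by apply/ffunP => l; rewrite !ffunE col_mxKu.
by apply/ffunP => l; rewrite !ffunE col_mxKd.
Qed.

Hypothesis uM : M \in unitmx.

Lemma face_inj m p (A B : tensor R m p n) :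
  (forall i, face M A i = face M B i) -> A = B.
Proof.
move=> eqAB.
(* The inverse transform recovers every slice from the faces. *)
have faceK (C : tensor R m p n) l :
    C l = \sum_(i < n) invmx M l i *: face M C i.
  under eq_bigr do rewrite faceE scaler_sumr.
  rewrite exchange_big /=.
  transitivity (\sum_(j < n) (invmx M *m M) l j *: C j).
    rewrite mulVmx // (bigD1 l) //= mxE eqxx scale1r big1 ?addr0 // => j jl.
    by rewrite mxE eq_sym (negPf jl) scale0r.
  apply: eq_bigr => j _; rewrite mxE scaler_suml; apply: eq_bigr => i _.
  by rewrite scalerA.
by apply/ffunP => l; rewrite (faceK A) (faceK B); apply: eq_bigr => i _; rewrite eqAB.
Qed.

Lemma face_star m p r (A : tensor R m p n) (B : tensor R p r n) i :
  face M (star M A B) i = face M A i *m face M B i.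
Proof. exact: face_of_faces. Qed.

Lemma face_ttr m p (A : tensor R m p n) i : face M (ttr M A) i = (face M A i)^T.
Proof. exact: face_of_faces. Qed.

Lemma face_reversal h i : face M (reversal M h) i = reversal_mx R h.
Proof. exact: face_of_faces. Qed.

Lemma star_symmetricP h p (A : tensor R (h + h) p n) :
  star_symmetric M A <->
  forall i, usubmx (face M A i) = reversal_mx R h *m dsubmx (face M A i).
Proof.
split=> [symA i | symA].
  by rewrite -face_upper symA face_star face_reversal face_lower.
by apply: face_inj => i; rewrite face_star face_reversal face_upper face_lower.
Qed.

End TensorFaces.

(** A scaled Parseval identity: each tube [x] becomes [c W x], whose squared norm is [c ^+ 2] times
    that of [x]. *)
Lemma frobenius_faces (R : realType) (m p n : nat) (M W : 'M[R]_n) (c : R)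
    (A : tensor R m p n) :
  W *m W^T = 1%:M -> c != 0 -> M = c *: W ->
  frobenius A = Num.sqrt (c ^- 2 * \sum_i mxnormsq (face M A i)).
Proof.
move=> orthW nzc ->; congr Num.sqrt; apply: (canRL (mulKf _)).
  by rewrite expf_neq0.
rewrite mulr_sumr; under [RHS]eq_bigr do rewrite mxnormsqE.
rewrite [RHS]exchange_big; apply: eq_bigr => a _ /=.
rewrite mulr_sumr [RHS]exchange_big; apply: eq_bigr => b _ /=.
pose x : 'cV[R]_n := \col_l A l a b.
have cV_normsq (y : 'cV[R]_n) : mxnormsq y = \sum_l y l 0 ^+ 2.
  by rewrite mxnormsqE; apply: eq_bigr => l _; rewrite big_ord1.
transitivity (c ^+ 2 * mxnormsq x).
  by rewrite cV_normsq; congr (_ * _); apply: eq_bigr => l _; rewrite mxE.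
transitivity (mxnormsq (c *: W *m x)).
  rewrite /mxnormsq trmx_mul linearZ /= -!scalemxAl -scalemxAr -scalemxAl linearZ /=.
  rewrite -!scalemxAr linearZ mulmxA -(mulmxA x^T) (mulmx1C orthW) mulmx1.
  by rewrite /= mulrA -expr2.
rewrite cV_normsq; apply: eq_bigr => i _; rewrite faceE mxE summxE.
by congr (_ ^+ 2); apply: eq_bigr => l _; rewrite !mxE.
Qed.

Lemma reversal_mx_sqr (R : realType) h :
  reversal_mx R h *m reversal_mx R h = 1%:M.
Proof.
apply/matrixP => i j; rewrite !mxE (bigD1 (rev_ord i)) //= !mxE eqxx mul1r.
rewrite rev_ordK eq_sym big1 ?addr0 // => l li.
by rewrite mxE (negPf li) mul0r.
Qed.

Lemma tr_reversal_mx (R : realType) h : (reversal_mx R h)^T = reversal_mx R h.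
Proof.
apply/matrixP => i j; rewrite !mxE.
by rewrite -(inj_eq rev_ord_inj) rev_ordK eq_sym.
Qed.

(** * The sptSVD as an ordinary singular value decomposition on each face *)

Section SymmetricSVD.
Variables (R : realType) (h p n r : nat) (M : 'M[R]_n).
Hypothesis uM : M \in unitmx.
Variables (A : tensor R (h + h) p n) (U : tensor R (h + h) r n).
Variables (S : tensor R r r n) (V : tensor R p r n).
Hypotheses (symA : star_symmetric M A) (svdA : sptSVD M A U S V).

(** The lower half of [U] is the reversal of its upper half, and reversing twice is the identity. *)
Lemma sptSVD_symmetric : star_symmetric M U.
Proof.
case: svdA => U0 [S0 [V0 [_ -> _ _]]]; apply/(star_symmetricP uM) => i.
rewrite faceZ face_stack face_star // face_reversal //.
rewrite !linearZ /= col_mxKu col_mxKd.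
by rewrite mulmxA reversal_mx_sqr mul1mx.
Qed.

(** Supplies the hypotheses of [eckart_young] on each face. Stacking doubles the squared length of
    the columns of [U0]; the factor [1 / sqrt 2] renormalises them, and the factor [sqrt 2] in [S]
    restores the product. *)
Lemma sptSVD_faces i :
  [/\ face M A i = face M U i *m face M S i *m (face M V i)^T,
      (face M U i)^T *m face M U i = 1%:M,
      (face M V i)^T *m face M V i = 1%:M,
      is_diag_mx (face M S i) &
      (forall j, 0 <= face M S i j j) /\
      (forall j j' : 'I_r, (j <= j')%N -> face M S i j' j' <= face M S i j j)].
Proof.
case: svdA => U0 [S0 [V0 [[defB /(_ i)[UU VV diagS S_ge0 Sdec]] -> -> ->]]].
have sqrt2 : Num.sqrt 2 != 0 :> R by rewrite sqrtr_eq0 -ltNge ltr0n.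
have sqr_sqrt2 : Num.sqrt 2 * Num.sqrt 2 = 2 :> R by rewrite -expr2 sqr_sqrtr.
(* By symmetry of [A] the two averaged halves coincide, so the matrix decomposed is the upper half
   of [A] itself. *)
have upA : usubmx (face M A i) = face M U0 i *m face M S0 i *m (face M V0 i)^T.
  rewrite -face_ttr // -!face_star // -defB faceZ faceD -symA face_upper.
  by rewrite -mulr2n -scaler_nat scalerA mulVf ?pnatr_eq0 // scale1r.
have dnA : dsubmx (face M A i) = reversal_mx R h *m usubmx (face M A i).
  have /(star_symmetricP uM)/(_ i) -> := symA.
  by rewrite mulmxA reversal_mx_sqr mul1mx.
rewrite !faceZ face_stack face_star // face_reversal //; split => //.
- rewrite -[LHS]vsubmxK dnA upA -!scalemxAl -!scalemxAr -scalemxAl scalerA.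
  by rewrite mulVf // scale1r !mul_col_mx !mulmxA.
(* The Gram matrix is half of [U0^T U0] plus [U0^T] times the squared reversal times [U0], that is,
   half of twice the identity. *)
- rewrite [(_ *: _)^T]linearZ /= -scalemxAl -scalemxAr scalerA tr_col_mx mul_row_col.
  rewrite trmx_mul tr_reversal_mx -mulmxA (mulmxA (reversal_mx R h)).
  rewrite reversal_mx_sqr mul1mx UU -mulr2n -scaler_nat scalerA -invfM sqr_sqrt2.
  by rewrite mulVf ?pnatr_eq0 // scale1r.
- by apply/is_diag_mxP => a b ab; rewrite mxE (elimT is_diag_mxP diagS) ?mulr0.
- split=> [j | j j' /Sdec le_jj']; rewrite !mxE.
    by rewrite mulr_ge0 ?sqrtr_ge0.
  by rewrite ler_wpM2l ?sqrtr_ge0.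
Qed.

End SymmetricSVD.

Theorem mainTheorem2 (R : realType) (h p n r k : nat)
    (M W : 'M[R]_n) (c : R)
    (orthW : W *m W^T = 1%:M) (nzc : c != 0) (defM : M = c *: W)
    (A : tensor R (h + h) p n) (symA : star_symmetric M A)
    (U : tensor R (h + h) r n) (S : tensor R r r n) (V : tensor R p r n)
    (svdA : sptSVD M A U S V)
    (k_gt0 : (1 <= k)%N) (lekr : (k <= r)%N) :
  let Ak := truncation M lekr U S V in
  (forall (X : tensor R (h + h) k n) (Y : tensor R k p n),
      frobenius (A - Ak) <= frobenius (A - star M X Y)) /\
  star_symmetric M Ak.
Proof.
move=> Ak.
have uM : M \in unitmx.
  have [uW _] := mulmx1_unit orthW.
  by rewrite defM unitmxZ // unitfE.
have faceAk i : face M Ak i =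
    colsub (widen_ord lekr) (face M U i) *m
    mxsub (widen_ord lekr) (widen_ord lekr) (face M S i) *m
    (colsub (widen_ord lekr) (face M V i))^T.
  by rewrite !face_star // face_ttr // !face_lead_cols face_lead_block.
split=> [X Y | ].
  (* Both norms are the same monotone function of a sum over faces, so it suffices to compare face
     by face. *)
  rewrite !(frobenius_faces _ orthW nzc defM); apply: ler_wsqrtr.
  apply: ler_wpM2l; first by rewrite invr_ge0 sqr_ge0.
  apply: ler_sum => i _; rewrite !faceB faceAk face_star //.
  have [-> UU VV diagS [S_ge0 Sdec]] := sptSVD_faces uM symA svdA i.
  exact: eckart_young.
apply/(star_symmetricP uM) => i; rewrite faceAk.
have /(star_symmetricP uM)/(_ i) symU := sptSVD_symmetric uM svdA.
rewrite -{1 2}[face M U i]vsubmxK symU.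
(* Column selection acts on the right, hence commutes with stacking and with the reversal on the
   left. *)
have -> : colsub (widen_ord lekr)
    (col_mx (reversal_mx R h *m dsubmx (face M U i)) (dsubmx (face M U i))) =
  col_mx (reversal_mx R h *m colsub (widen_ord lekr) (dsubmx (face M U i)))
         (colsub (widen_ord lekr) (dsubmx (face M U i))).
  by rewrite mulmx_colsub; apply/matrixP => a b; rewrite !mxE; case: split => ?; rewrite [RHS]mxE.
by rewrite !mul_col_mx col_mxKu col_mxKd !mulmxA.
Qed.
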